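(* Let $x\in X^\omega$, $X=\{0,1\}$, be a rational (i.e. eventually periodic) point of the Cantor set other than $000\ldots$ and $111\ldots$. Then $x$ can be written uniquely either as $x=1^n0vwww\ldots$ with $n\ge1$ or as $x=0^m1vwww\ldots$ with $m\ge1$, for some $v,w\in X^*$ such that $w$ is nonempty and not a proper power and the last letter of $v$ (if $v$ is nonempty) differs from the last letter of $w$. Write $w^\infty=www\ldots$ and let $\sigma$ be the shift on $X^\omega$. The Schreier graph $\Gamma_x$ of the action of $F$ on the orbit of $x$ with respect to $\{x_0,x_1\}$, pointed at $x$, is isomorphic, as a pointed directed graph with edges labeled by $x_0,x_1$, to the graph $Q(w)$ defined in the context, with base vertex $a_{n-1}(\gamma)$ (where $a_0(\gamma):=\gamma$) if $x=1^n0vw^\infty$, and $b_m(\gamma)$ if $x=0^m1vw^\infty$, where $\gamma=c_0$ if $v=\varnothing$ and $\gamma=d_0(v_1\cdots v_{l-1})$ if $v=v_1\cdots v_l$ with $l\geq1$. Moreover, when the vertices of $Q(w)$ are labeled by the corresponding points of the orbit of $x$, the graph has the following structure: (1) the base point is labeled by $x$; (2) each vertex labeled by $10u$ with $u\ne\sigma^i(w^\infty)$ for all $i\ge0$ is the root of a hanging graph canonically isomorphic to $H$ (the graph hanging down from the vertex $101000\ldots$ in the Schreier graph $\Gamma$ of $\frac12$); (3) the upward path of grey vertices connecting the vertices $10vw^\infty$ and $10\sigma^{|w|-1}(w^\infty)$ turns left at the $k$-th level (from the right child to its parent) if the $k$-th letter of $vw$ is $0$, and turns right at the $k$-th level (from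 the left child to its parent) if the $k$-th letter of $vw$ is $1$; (4) if the last letter of $w$ is $0$, then there is an edge from the vertex $10w^\infty$ to the vertex $10\sigma^{|w|-1}(w^\infty)$ labeled by $x_1$; (5) if the last letter of $w$ is $1$, then the vertex $110w^\infty$ is adjacent to the vertices $10w^\infty$ and $10\sigma^{|w|-1}(w^\infty)$ via edges labeled by $x_0$ and $x_1$, respectively; (6) the part of the path in (3) from $10w^\infty$ to $10\sigma^{|w|-1}(w^\infty)$, together with the edge in (4) or the path in (5), forms a loop in the graph, called the nontrivial loop; (7) each vertex adjacent to a grey vertex of the nontrivial loop and not belonging to this loop is either the beginning of a geodesic ray isomorphic to the geodesic ray $(1,01,001,\ldots)$ in $\Gamma$ (consecutive vertices joined by edges labeled $x_0$, with a loop labeled $x_1$ at each vertex), or the root of a graph isomorphic to $H_\ell$ (the graph hanging down and to the left at the vertex $11$ in $\Gamma$), or the root of a graph isomorphic to $H_r$ (the graph hanging down and to the right at the vertex $101$ in $\Gamma$).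
   Context: Thompson's group $F$ is the group of all strictly increasing piecewise linear homeomorphisms of $[0,1]$ that are differentiable except at finitely many dyadic rationals and whose slopes are integer powers of $2$; products are read left to right, $(fg)(x)=g(f(x))$, and $x^f:=f(x)$. It is generated by $x_0,x_1$, where $x_0(t)=t/2$ on $[0,\frac12]$, $t-\frac14$ on $[\frac12,\frac34]$, $2t-1$ on $[\frac34,1]$; and $x_1(t)=t$ on $[0,\frac12]$, $\frac t2+\frac14$ on $[\frac12,\frac34]$, $t-\frac18$ on $[\frac34,\frac78]$, $2t-1$ on $[\frac78,1]$. The standard action of $F$ on the Cantor set $X^\omega$ of infinite words over $X=\{0,1\}$ is induced by binary expansions and is given by $x_0: 0u\mapsto 00u,\ 10u\mapsto 01u,\ 11u\mapsto 1u$; $x_1: 0u\mapsto 0u,\ 10u\mapsto 100u,\ 110u\mapsto 101u,\ 111u\mapsto 11u$. Schreier graph $\Gamma_x$, $x\in X^\omega$: the vertices are the points of the $F$-orbit of $x$ in $X^\omega$, and for $s\in\{x_0,x_1\}$ there is a directed edge labeled $s$ from $y$ to $z$ iff $y^s=z$; the base vertex is $x$. $\Gamma$ denotes the Schreier graph of the orbit of $1000\ldots\in X^\omega$ (i.e. of $\frac12$); its vertices are written as finite words, with trailing zeros omitted. $X^*$ is the set of finite words and $\varnothing$ is the empty word; $\sigma(y_1y_2y_3\ldots)=y_2y_3\ldots$. Attaching rays. Given a set of grey vertices, each having a left child and a right child among the grey vertices, attach to each grey vertex $v$ white vertices $a_i(v)$ and black vertices $b_i(v)$, $i\ge1$ (all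 distinct), with edges, for all $v$ and $i\ge1$: labeled $x_0$: $v\to b_1(v)$, $b_i(v)\to b_{i+1}(v)$, $a_1(v)\to v$, $a_{i+1}(v)\to a_i(v)$; labeled $x_1$: a loop at $b_i(v)$, $a_{i+1}(v)\to a_i(v)$, $a_1(v)\to$ (left child of $v$), $v\to$ (right child of $v$). Under the labeling by points of $X^\omega$, grey vertices are those whose label begins with $10$. The graphs $H,H_\ell,H_r$. $H$ is the graph obtained by attaching rays to the grey vertices $h(p)$, $p\in X^*$, where $h(p)$ has left child $h(1p)$ and right child $h(0p)$; its root is $h(\varnothing)$. $H_\ell$ is the subgraph of $H$ induced on all $a_i(h(\varnothing))$, $i\ge1$, together with $h(p1)$, $a_i(h(p1))$, $b_i(h(p1))$ for $p\in X^*$, $i\ge1$; its root is $a_1(h(\varnothing))$. $H_r$ is the subgraph of $H$ induced on $h(p0)$, $a_i(h(p0))$, $b_i(h(p0))$ for $p\in X^*$, $i\ge1$; its root is $h(0)$. The graph $Q(w)$ for $w=w_1\cdots w_L$, $L\ge1$. The grey vertices are $c_i$ ($i\in\mathbb Z/L$) and $d_i(p)$ ($i\in\mathbb Z/L$, $p\in X^*$). The left child of $d_i(p)$ is $d_i(1p)$ and its right child is $d_i(0p)$. For $0\le i\le L-1$ (index $i+1$ of $c,d$ taken modulo $L$): if $w_{i+1}=0$, then the right child of $c_{i+1}$ is $c_i$ and its left child is $d_{i+1}(\varnothing)$; if $w_{i+1}=1$, then the left child of $c_{i+1}$ is $c_i$ and its right child is $d_{i+1}(\varnothing)$. $Q(w)$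 is obtained by attaching rays to these grey vertices. *)

(* Defs.v *)
(* MathComp; the letters 0 and 1 are the booleans false and true. *)
From mathcomp Require Import all_boot.
From Stdlib Require List.

Set Implicit Arguments.
Unset Strict Implicit.
Unset Printing Implicit Defensive.

(** * Words and the Cantor set *)

Definition word := seq bool.
Definition Xomega := nat -> bool.

Definition wcat (p : word) (u : Xomega) : Xomega :=
  fun n => if n < size p then nth false p n else u (n - size p).
Notation "p +++ u" := (wcat p u) (at level 60, right associativity).

Definition shift (k : nat) (u : Xomega) : Xomega := fun n => u (n + k).

Definition constw (b : bool) : Xomega := fun _ => b.

(* [omega w] is www..., meaningful for nonempty [w] only. *)
Definition omega (w : word) : Xomega := fun n => nth false w (n %% size w).

Definition rational (x : Xomega) : Prop :=
  exists N p, 0 < p /\ forall n, N <= n -> x (n + p) = x n.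

Definition proper_power (w : word) : Prop :=
  exists (u : word) (k : nat), 1 < k /\ w = flatten (nseq k u).

(** * Thompson's group F acting on the Cantor set *)

Inductive generator := x0 | x1.

Definition act_x0 (y : Xomega) : Xomega :=
  if y 0 then
    if y 1 then [:: true] +++ shift 2 y
    else [:: false; true] +++ shift 2 y
  else [:: false; false] +++ shift 1 y.

Definition act_x1 (y : Xomega) : Xomega :=
  if y 0 then
    if y 1 then
      if y 2 then [:: true; true] +++ shift 3 y
      else [:: true; false; true] +++ shift 3 y
    else [:: true; false; false] +++ shift 2 y
  else y.

Definition act (s : generator) : Xomega -> Xomega :=
  match s with x0 => act_x0 | x1 => act_x1 end.

(* F is generated by x_0 and x_1, so its standard action on X^omega is the
   group of permutations generated by [act x0] and [act x1]; [thompsonF f]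
   says that [f] is the permutation given by some element of F. *)
Inductive thompsonF : (Xomega -> Xomega) -> Prop :=
| F_gen s : thompsonF (act s)
| F_one : thompsonF id
| F_mul f g : thompsonF f -> thompsonF g -> thompsonF (g \o f)
| F_inv f g : thompsonF f -> cancel f g -> cancel g f -> thompsonF g.

Definition orbit (x y : Xomega) : Prop := exists f, thompsonF f /\ f x = y.

Lemma orbit_refl x : orbit x x.
Proof. by exists id; split; first exact: F_one. Qed.

(** * Directed graphs with edges labeled by x_0, x_1 *)

Record lgraph := LGraph {
  vertex :> Type;
  edge : generator -> vertex -> vertex -> Prop
}.

Definition isomorphism (G K : lgraph) (f : G -> K) : Prop :=
  bijective f /\ forall s y z, edge s y z <-> edge s (f y) (f z).

Definition induced (G : lgraph) (P : G -> Prop) : lgraph :=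
  @LGraph {y : G | P y} (fun s y z => edge s (sval y) (sval z)).

Definition adjacent (G : lgraph) (y z : G) : Prop :=
  exists s, edge s y z \/ edge s z y.

(* Walks in the underlying undirected multigraph: the step [(s, fwd, z)] goes
   to [z] along an edge labeled [s], in its direction iff [fwd]. *)
Definition step (G : lgraph) : Type := (generator * bool * G)%type.

Fixpoint walk (G : lgraph) (y : G) (ts : seq (step G)) (z : G) : Prop :=
  if ts is (s, fwd, y') :: ts' then
    (if fwd then edge s y y' else edge s y' y) /\ walk y' ts' z
  else y = z.

Definition visited (G : lgraph) (ts : seq (step G)) : seq G :=
  [seq t.2 | t <- ts].

Fixpoint edges (G : lgraph) (y : G) (ts : seq (step G)) :
    seq (generator * G * G) :=
  if ts is (s, fwd, y') :: ts' then
    (if fwd then (s, y, y') else (s, y', y)) :: edges y' ts'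
  else [::].

(* A loop is a simple cycle of the undirected multigraph; its length may be 1
   (an edge from a vertex to itself) or 2 (two parallel edges). *)
Definition loop (G : lgraph) (y : G) (ts : seq (step G)) : Prop :=
  [/\ ts <> [::], walk y ts y, List.NoDup (visited ts)
    & List.NoDup (edges y ts)].

(* [f] identifies [K] with an induced subgraph of [G] that hangs at the image
   of [r]: it is connected to the rest of [G] through that vertex only. *)
Definition hanging (G K : lgraph) (r : K) (f : K -> G) : Prop :=
  [/\ injective f,
      forall s k l, edge s k l <-> edge s (f k) (f l)
    & forall k y, (forall l, f l <> y) -> adjacent (f k) y -> k = r].

Definition geodesic_ray (G : lgraph) (r : nat -> G) : Prop :=
  [/\ forall i, edge x0 (r i) (r i.+1),
      forall i, edge x1 (r i) (r i)
    & forall i j ts, i <= j -> walk (r i) ts (r j) -> j - i <= size ts].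

(** * Schreier graphs *)

Definition schreier (x : Xomega) : lgraph :=
  @LGraph {y : Xomega | orbit x y} (fun s y z => act s (sval y) = sval z).

Definition schreier_base (x : Xomega) : schreier x :=
  exist _ x (orbit_refl x).

(* A finite word stands for a vertex of Gamma, trailing zeros being omitted. *)
Definition fin (p : word) : Xomega := p +++ constw false.

Definition Gamma : lgraph := schreier (fin [:: true]).

(** * Attaching rays *)

(* [White v i] and [Black v i] are a_{i+1}(v) and b_{i+1}(v). *)
Inductive ray_vertex (Grey_t : Type) : Type :=
| Grey of Grey_t
| White of Grey_t & nat
| Black of Grey_t & nat.
Arguments Grey {Grey_t}.
Arguments White {Grey_t}.
Arguments Black {Grey_t}.

(* With a_0(v) = b_0(v) = v. *)
Definition va (T : Type) (v : T) (i : nat) : ray_vertex T :=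
  if i is j.+1 then White v j else Grey v.
Definition vb (T : Type) (v : T) (i : nat) : ray_vertex T :=
  if i is j.+1 then Black v j else Grey v.

(* [child false v] is the right child of [v], [child true v] its left child. *)
Inductive ray_edge (T : Type) (child : bool -> T -> T) :
  generator -> ray_vertex T -> ray_vertex T -> Prop :=
| e0_b v i : ray_edge child x0 (vb v i) (vb v i.+1)
| e0_a v i : ray_edge child x0 (va v i.+1) (va v i)
| e1_b v i : ray_edge child x1 (vb v i.+1) (vb v i.+1)
| e1_a v i : ray_edge child x1 (va v i.+2) (va v i.+1)
| e1_left v : ray_edge child x1 (va v 1) (Grey (child true v))
| e1_right v : ray_edge child x1 (Grey v) (Grey (child false v)).

Definition attach_rays (T : Type) (child : bool -> T -> T) : lgraph :=
  LGraph (ray_edge child).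

(* [upward_walk child y p z]: [p] lists the successive moves from a grey vertex
   to its parent leading from [y] to [z], as pairs (turn, parent).  The turn is
   [false] (a left turn) from the right child to its parent and [true] (a right
   turn) from the left child to its parent. *)
Fixpoint upward_walk (T : Type) (child : bool -> T -> T)
    (y : T) (p : seq (bool * T)) (z : T) : Prop :=
  if p is (b, y') :: p' then y = child b y' /\ upward_walk child y' p' z
  else y = z.

Definition upward_path (T : Type) (child : bool -> T -> T)
    (y : T) (p : seq (bool * T)) (z : T) : Prop :=
  upward_walk child y p z /\ List.NoDup (y :: unzip2 p).

(* The steps made in the graph by an upward walk: from a left child one passes
   through the vertex a_1 of the parent. *)
Definition climb (T : Type) (child : bool -> T -> T) (p : seq (bool * T)) :
    seq (step (attach_rays child)) :=
  flatten [seq (if m.1 then [:: (x1, false, va m.2 1); (x0, true, Grey m.2)]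
                else [:: (x1, false, Grey m.2)]) | m <- p].

(** * The graphs H, H_l, H_r *)

Definition Hchild (b : bool) (p : word) : word := b :: p.

Definition H : lgraph := attach_rays Hchild.
Definition Hroot : H := Grey [::].

Definition grey_of (T : Type) (y : ray_vertex T) : T :=
  match y with Grey v | White v _ | Black v _ => v end.

Definition in_Hl (y : H) : Prop :=
  (exists i, y = va [::] i.+1) \/ exists p, grey_of y = rcons p true.
Definition Hl : lgraph := induced in_Hl.
Definition Hl_root : Hl :=
  exist in_Hl (va [::] 1) (or_introl (ex_intro _ 0 erefl)).

Definition in_Hr (y : H) : Prop := exists p, grey_of y = rcons p false.
Definition Hr : lgraph := induced in_Hr.
Definition Hr_root : Hr :=
  exist in_Hr (Grey [:: false]) (ex_intro _ [::] erefl).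

(* The labeling of H as the graph hanging down from the vertex 10u. *)
Definition Hlabel (u : Xomega) (y : H) : Xomega :=
  match y with
  | Grey p => [:: true; false] +++ p +++ u
  | White p i => nseq i.+1 true +++ [:: true; false] +++ p +++ u
  | Black p i => nseq i.+1 false +++ [:: true] +++ p +++ u
  end.

(** * The graph Q(w) *)

(* Z/L for L = |w| >= 1, in a form that is syntactically inhabited. *)
Definition Zmod (w : word) : Type := 'I_(size w).-1.+1.

Inductive Qgrey (w : word) : Type :=
| Qc of Zmod w
| Qd of Zmod w & word.
Arguments Qc {w}.
Arguments Qd {w}.

(* [nth false w (ord_pred j)] is the letter w_{i+1} when j = i+1 in Z/L. *)
Definition Qchild (w : word) (b : bool) (v : Qgrey w) : Qgrey w :=
  match v with
  | Qc j => if b == nth false w (ord_pred j) then Qc (ord_pred j)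
            else Qd j [::]
  | Qd j p => Qd j (b :: p)
  end.

Definition Q (w : word) : lgraph := attach_rays (@Qchild w).

(* The vertex gamma; [belast a v'] is [a :: v'] without its last letter. *)
Definition Qgamma (v w : word) : Qgrey w :=
  if v is a :: v' then Qd ord0 (belast a v') else Qc ord0.

(* x = 1^n 0 v w^omega if [b = true], and x = 0^n 1 v w^omega if [b = false]. *)
Definition standard_form (x : Xomega) (t : bool * nat * word * word) : Prop :=
  let: (b, n, v, w) := t in
  [/\ 1 <= n, x = nseq n b +++ [:: ~~ b] +++ v +++ omega w,
      w <> [::], ~ proper_power w
    & v <> [::] -> last false v <> last false w].

Definition Qbase (b : bool) (n : nat) (v w : word) : Q w :=
  if b then va (Qgamma v w) n.-1 else vb (Qgamma v w) n.

(* Main.v *)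
Require Import Defs.
From mathcomp Require Import all_boot.
From Stdlib Require List.
From Stdlib Require Import Classical FunctionalExtensionality IndefiniteDescription.

Set Implicit Arguments.
Unset Strict Implicit.
Unset Printing Implicit Defensive.

(** Reading off the initial run of equal letters, every nonconstant point of the
    Cantor set is [10u], [1^i 10u] or [0^i 1u] with [i >= 1], for exactly one [u]
    and [i].  In these coordinates the generators act on the nonconstant points
    as on the graph obtained by attaching rays to grey vertices [u], where the
    two children of [u] are [0u] and [1u] ([act_rlabel], [rlabel_inj]).  So a map
    from a set of grey vertices to infinite words which sends children to
    children extends to a map of graphs with attached rays into the action.

    For [Q w] this map is [tail]: it sends [Qc j] to [shift j (omega w)] and
    [Qd j p] to [p], then the letter which does not precede
    [shift j (omega w)] periodically, then [shift j (omega w)].  It is injective because [w] is primitive: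
    the positions [j] are then distinguished by the shifts of [omega w]
    ([period_primitive]), and a wrong letter cannot occur inside the periodic
    word.  Since [Q w] is connected and each of its vertices has one incoming
    edge per label, its labels form exactly one orbit, which gives the
    isomorphism with the Schreier graph of any point among them
    ([Qlabel_isomorphism]).  The graph of one half is the case of the
    one-letter word [w = 0], so that everything proved about the graphs [Q w]
    applies to it.

    In the standard form, [v] is the shortest preperiod and [w] the shortest
    period of what follows the initial run and the letter ending it: a longer
    preperiod would make the last letters of [v] and [w] equal, and a longer
    period would make [w] a proper power.

    The geometric statements are then read off [Q w].  The vertices under
    [Qd j p] form a copy of [H], of which [Hr] is again a copy; [Hl] is what
    hangs at [a_1] of a vertex [Qc j] whose left child is off the cycle; a black
    ray is geodesic because an edge moves by at most one along it.  As a grey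
    vertex determines its parent, upward paths are unique; the one from [Qc 0]
    around the cycle of the [Qc j] back to [Qc 0] is the nontrivial loop, and
    what it misses next to [Qc j] is the black ray, and the left or the right
    side of [Qc j]. *)

(** * Infinite words *)

Lemma wcat0 u : [::] +++ u = u.
Proof. by apply: functional_extensionality => n; rewrite /wcat subn0. Qed.

Lemma wcat_cons a p u : (a :: p) +++ u = [:: a] +++ p +++ u.
Proof. by apply: functional_extensionality => -[|n] //; rewrite /wcat /= subn1. Qed.

Lemma wcat_cat p q u : (p ++ q) +++ u = p +++ q +++ u.
Proof.
elim: p => [|a p IHp]; first by rewrite wcat0.
by rewrite cat_cons wcat_cons IHp -wcat_cons.
Qed.

Lemma shift0 u : shift 0 u = u.
Proof. by apply: functional_extensionality => n; rewrite /shift addn0. Qed.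

Lemma shift_shift i k u : shift i (shift k u) = shift (i + k) u.
Proof. by apply: functional_extensionality => n; rewrite /shift addnA. Qed.

Lemma shift_wcat p u : shift (size p) (p +++ u) = u.
Proof.
apply: functional_extensionality => n.
by rewrite /shift /wcat ltnNge leq_addl /= addnK.
Qed.

Lemma shiftS_wcat k a p u : shift k.+1 ((a :: p) +++ u) = shift k (p +++ u).
Proof. by apply: functional_extensionality => n; rewrite /shift addnS. Qed.

Lemma wcat_head u : u = [:: u 0] +++ shift 1 u.
Proof.
by apply: functional_extensionality => -[|n] //; rewrite /wcat /= /shift subn1 addn1.
Qed.

Lemma wcat_cons_inj a b p q u v :
  (a :: p) +++ u = (b :: q) +++ v -> a = b /\ p +++ u = q +++ v.
Proof.
move=> e; split; first by have := congr1 (fun f => f 0) e.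
have := congr1 (shift 1) e.
by rewrite !shiftS_wcat !shift0.
Qed.

Lemma wcat_inj p u v : p +++ u = p +++ v -> u = v.
Proof. by move=> /(congr1 (shift (size p))); rewrite !shift_wcat. Qed.

(** * The generators on the nonconstant points *)

Definition act_inv (s : generator) (y : Xomega) : Xomega :=
  match s with
  | x0 => if y 0 then [:: true; true] +++ shift 1 y
          else if y 1 then [:: true; false] +++ shift 2 y
          else [:: false] +++ shift 2 y
  | x1 => if y 0 then
            if y 1 then [:: true; true; true] +++ shift 2 y
            else if y 2 then [:: true; true; false] +++ shift 3 y
            else [:: true; false] +++ shift 3 y
          else y
  end.

Lemma wcat_head3 u : exists a b c v, u = [:: a; b; c] +++ v.
Proof.
exists (u 0), (u 1), (u 2), (shift 3 u).
by rewrite {1}[u]wcat_head [shift 1 u]wcat_head [shift 1 (shift 1 u)]wcat_head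
  !shift_shift -!wcat_cat.
Qed.

Lemma actK s : cancel (act s) (act_inv s).
Proof.
move=> u; have [a [b [c [v ->]]]] := wcat_head3 u.
case: s a b c => [] [] [] []; rewrite /= /act_x0 /act_x1 /act_inv /=;
  by rewrite ?(shiftS_wcat, shift0, wcat0) -?wcat_cat.
Qed.

Lemma act_invK s : cancel (act_inv s) (act s).
Proof.
move=> u; have [a [b [c [v ->]]]] := wcat_head3 u.
case: s a b c => [] [] [] []; rewrite /= /act_x0 /act_x1 /act_inv /=;
  by rewrite ?(shiftS_wcat, shift0, wcat0) -?wcat_cat.
Qed.

Lemma act_inj s : injective (act s).
Proof. exact: can_inj (actK s). Qed.

Lemma thompsonF_invertible f :
  thompsonF f -> exists2 g, cancel f g & cancel g f.
Proof.
elim=> [s||f1 g1 _ [f2 fK fVK] _ [g2 gK gVK]|f1 g1 _ _ fK fVK].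
- by exists (act_inv s); [exact: actK | exact: act_invK].
- by exists id.
- by exists (f2 \o g2); apply: can_comp.
- by exists f1.
Qed.

Lemma orbit_sym x y : Defs.orbit x y -> Defs.orbit y x.
Proof.
case=> f [Ff <-]; have [g fK gK] := thompsonF_invertible Ff.
by exists g; split; [exact: F_inv Ff fK gK | exact: fK].
Qed.

Lemma orbit_trans y x z : Defs.orbit x y -> Defs.orbit y z -> Defs.orbit x z.
Proof. by case=> f [Ff <-] [g [Fg <-]]; exists (g \o f); split; first exact: F_mul. Qed.

Lemma orbit_act s x : Defs.orbit x (act s x).
Proof. by exists (act s); split; first exact: F_gen. Qed.

(** With an implication only, the step for inverses would fail. *)
Lemma orbit_invariant (P : Xomega -> Prop) x y :
  (forall s u, P u <-> P (act s u)) -> Defs.orbit x y -> P x -> P y.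
Proof.
move=> Pact [f [Ff <-]].
suff Pf u : P u <-> P (f u) by case: (Pf x).
elim: Ff u => [s||f1 g1 _ IHf _ IHg|f1 g1 _ IHf _ gK] u //.
  by have [h1 h2] := IHf u; have [h3 h4] := IHg (f1 u); split; auto.
by have [h1 h2] := IHf (g1 u); rewrite gK in h1 h2; split.
Qed.

(** * Graphs with attached rays *)

(** The end of the unique edge labeled [s] which starts at [y]. *)
Definition target (T : Type) (child : bool -> T -> T) (s : generator)
    (y : ray_vertex T) : ray_vertex T :=
  match s, y with
  | x0, Grey v => Black v 0
  | x0, White v i => va v i
  | x0, Black v i => Black v i.+1
  | x1, Grey v => Grey (child false v)
  | x1, White v 0 => Grey (child true v)
  | x1, White v i.+1 => White v i
  | x1, Black v i => Black v i
  end.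

Lemma ray_edgeE T (child : bool -> T -> T) s y z :
  edge (l := attach_rays child) s y z <-> target child s y = z.
Proof.
split=> [|<-]; first by case=> // v [].
case: s y => [] [v|v i|v i] /=.
- exact: (e0_b child v 0).
- exact: (e0_a child v i).
- exact: (e0_b child v i.+1).
- exact: (e1_right child v).
- by case: i => [|i]; [exact: (e1_left child v) | exact: (e1_a child v i)].
- exact: (e1_b child v i).
Qed.

Lemma target_onto T (child : bool -> T -> T) s z :
  (forall v, exists b v', v = child b v') -> exists y, target child s y = z.
Proof.
move=> parent; case: s z => [] [v|v i|v i].
- by exists (White v 0).
- by exists (White v i.+1).
- by case: i => [|i]; [exists (Grey v) | exists (Black v i)].
- have [[] [v' ->]] := parent v; first by exists (White v' 0).
  by exists (Grey v').
- by exists (White v i.+1).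
- by exists (Black v i).
Qed.

Definition map_ray (T T' : Type) (g : T -> T') (y : ray_vertex T) :
    ray_vertex T' :=
  match y with
  | Grey v => Grey (g v)
  | White v i => White (g v) i
  | Black v i => Black (g v) i
  end.

Lemma grey_of_map T T' (g : T -> T') y : grey_of (map_ray g y) = g (grey_of y).
Proof. by case: y. Qed.

Lemma map_ray_inj_at T T' (g : T -> T') y z :
  map_ray g y = map_ray g z -> grey_of y = grey_of z -> y = z.
Proof. by case: y z => [v|v i|v i] [v'|v' i'|v' i'] /= *; congruence. Qed.

Lemma map_ray_inj T T' (g : T -> T') : injective g -> injective (map_ray g).
Proof.
move=> g_inj y z e; apply: (map_ray_inj_at e); apply: g_inj.
by rewrite -!(grey_of_map g) e.
Qed.

Lemma target_map T T' (child : bool -> T -> T) (child' : bool -> T' -> T') g :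
  (forall b v, g (child b v) = child' b (g v)) ->
  forall s y, target child' s (map_ray g y) = map_ray g (target child s y).
Proof. by move=> gE [] [v|v [|i]|v i] //=; rewrite gE. Qed.

Definition push (b : bool) (u : Xomega) : Xomega := [:: b] +++ u.

Definition rlabel (y : ray_vertex Xomega) : Xomega :=
  match y with
  | Grey u => [:: true; false] +++ u
  | White u i => nseq i.+1 true +++ [:: true; false] +++ u
  | Black u i => nseq i.+1 false +++ [:: true] +++ u
  end.

Lemma act_rlabel s y : act s (rlabel y) = rlabel (target push s y).
Proof.
by case: s y => [] [u|u [|[|i]]|u [|i]];
  rewrite /= /act_x0 /act_x1 /push /=;
  rewrite ?(shiftS_wcat, shift0, wcat0) -?wcat_cat.
Qed.

Lemma nseq_run_inj a b i j u v :
  nseq i a +++ [:: ~~ a] +++ u = nseq j b +++ [:: ~~ b] +++ v ->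
  0 < i -> 0 < j -> [/\ a = b, i = j & u = v].
Proof.
case: i j => [|i] [|j] //= e _ _.
have [e1 e2] := wcat_cons_inj e; rewrite -e1 in e2 *.
suff [-> ->] : i = j /\ u = v by [].
elim: i j e2 {e} => [|i IHi] [|j] /= ; rewrite ?wcat0.
- by move=> /wcat_inj.
- by move=> /wcat_cons_inj[]; case: (a).
- by move=> /wcat_cons_inj[]; case: (a).
by move=> /wcat_cons_inj[_ /IHi[-> ->]].
Qed.

(** The length of the initial run of equal letters locates the vertex on its
    ray, and what follows the first different letter is its grey vertex. *)
Lemma rlabel_run y : exists a i,
  rlabel y = nseq i.+1 a +++ [:: ~~ a] +++ grey_of y
  /\ y = if a then va (grey_of y) i else vb (grey_of y) i.+1.
Proof.
case: y => [u|u i|u i].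
- by exists true, 0; split; rewrite //= -wcat_cat.
- exists true, i.+1; split=> //.
  rewrite /rlabel (wcat_cons true [:: _]) -(wcat_cat (nseq _ _) [:: true]).
  by rewrite -[[:: true]]/(nseq 1 true) -nseqD addn1.
- by exists false, i.
Qed.

Lemma rlabel_inj : injective rlabel.
Proof.
move=> y z; have [a [i [-> yE]]] := rlabel_run y; have [b [j [-> zE]]] := rlabel_run z.
move/nseq_run_inj=> /(_ isT isT) [ab [ij] e].
by rewrite yE zE ab ij e.
Qed.

(** * Periodic words *)

Lemma shift_modn_omega w k : shift (k %% size w) (omega w) = shift k (omega w).
Proof. by apply: functional_extensionality => n; rewrite /shift /omega modnDmr. Qed.

Lemma omega_period w n k : omega w (n + k * size w) = omega w n.
Proof. by rewrite /omega addnC modnMDl. Qed.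

Lemma period_iter f k n m :
  (forall n, f (n + k) = f n) -> f (n + m * k) = f n :> bool.
Proof.
by move=> fk; elim: m => [|m IHm]; rewrite ?addn0 // mulSn [k + _]addnC addnA fk.
Qed.

Lemma nth_power (u : word) k n :
  n < k * size u -> nth false (flatten (nseq k u)) n = nth false u (n %% size u).
Proof.
elim: k n => [|k IHk] n //=; rewrite mulSn => nk; rewrite nth_cat.
case: ltnP => [nu|un]; first by rewrite modn_small.
rewrite IHk ?ltn_subLR //; first by rewrite -{2}(subnK un) modnDr.
Qed.

(** By Bezout the greatest common divisor of [k] and [size w] is again a period
    of [omega w]; were it smaller than [size w], then [w] would be a power of its
    prefix of that length. *)
Lemma period_primitive w k :
  w <> [::] -> ~ proper_power w -> (forall n, omega w (n + k) = omega w n) ->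
  size w %| k.
Proof.
move=> w0 wP wk; have w_gt0 : 0 < size w by case: (w) w0.
case: (posnP k) => [-> //|k_gt0].
set g := gcdn k (size w).
have wg n : omega w (n + g) = omega w n.
  case: (egcdnP (size w) k_gt0) => km kn kE _.
  by rewrite -(period_iter n km wk) kE addnCA (addnC (kn * _)) omega_period.
have g_gt0 : 0 < g by rewrite gcdn_gt0 k_gt0.
have /dvdnP[m wE] : g %| size w := dvdn_gcdr _ _.
suff m1 : m <= 1.
  suff <- : g = size w by exact: dvdn_gcdl.
  by rewrite wE; case: m m1 wE => [|[]] //; rewrite ?mul1n // => _ E; rewrite E in w_gt0.
rewrite leqNgt; apply/negP => m1; apply: wP; exists (take g w), m; split=> //.
have gw : size (take g w) = g by rewrite size_takel // dvdn_leq // dvdn_gcdr.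
have sz j : size (flatten (nseq j (take g w))) = j * g.
  by elim: j => //= j IHj; rewrite size_cat IHj gw mulSn.
apply: (@eq_from_nth _ false) => [|i iw]; first by rewrite sz.
rewrite nth_power ?gw -?wE // nth_take ?ltn_mod //.
rewrite -[in LHS](modn_small iw) -/(omega w i) {1}(divn_eq i g) addnC.
rewrite (period_iter _ _ wg) /omega modn_small //.
by rewrite (leq_trans (ltn_pmod _ g_gt0)) // dvdn_leq // dvdn_gcdr.
Qed.

Lemma shift_omega_inj w i j :
  w <> [::] -> ~ proper_power w -> shift i (omega w) = shift j (omega w) ->
  i = j %[mod size w].
Proof.
move=> w0 wP; wlog ij : i j / i <= j.
  by move=> IH e; case/orP: (leq_total i j) => /IH ->.
move=> e; apply/eqP; rewrite eq_sym eqn_mod_dvd //; apply: period_primitive => // n.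
have w_gt0 : 0 < size w by case: (w) w0.
(* moving on by [i] periods makes room to subtract [i] *)
rewrite -[LHS](omega_period _ _ i) -[RHS](omega_period _ _ i).
have iw : i <= i * size w by rewrite leq_pmulr.
have := congr1 (fun f => f (n + (i * size w - i))) e; rewrite /shift.
rewrite -!addnA subnK // => ->; congr (omega w (_ + _)).
by rewrite !addnBAC // addnC.
Qed.

(** * Labels of the vertices of Q(w) *)

(** A grey vertex [v] of [Q w] stands for the point [10] followed by [tail v].
    The vertices [Qd j p] are the tails which leave the periodic sequence of
    predecessors of [shift j (omega w)] by a wrong letter. *)
Definition tail (w : word) (v : Qgrey w) : Xomega :=
  match v with
  | Qc j => shift j (omega w)
  | Qd j p => p +++ [:: ~~ nth false w (ord_pred j)] +++ shift j (omega w)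
  end.

Lemma size_pred (w : word) : w <> [::] -> (size w).-1.+1 = size w.
Proof. by case: w. Qed.

Lemma ltn_Zmod (w : word) (j : Zmod w) : w <> [::] -> j < size w.
Proof. by move=> w0; have := ltn_ord j; rewrite {2}size_pred. Qed.

Lemma ord_pred_modn (w : word) (j : Zmod w) : w <> [::] ->
  (ord_pred j).+1 = j %[mod size w].
Proof.
case: w j => // a w j _.
by rewrite -[in RHS](ord_predK j) /= modn_mod.
Qed.

Lemma shift_ord_pred (w : word) (j : Zmod w) : w <> [::] ->
  shift (ord_pred j) (omega w) =
  [:: nth false w (ord_pred j)] +++ shift j (omega w).
Proof.
move=> w0; rewrite {1}[shift _ _]wcat_head shift_shift add1n; congr (_ +++ _).
  by rewrite /shift /omega add0n modn_small // ltn_Zmod.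
rewrite -shift_modn_omega -(shift_modn_omega w j).
by rewrite ord_pred_modn.
Qed.

Lemma tail_child w b (v : Qgrey w) : w <> [::] -> tail (Qchild b v) = push b (tail v).
Proof.
move=> w0; case: v => [j|j p]; last by rewrite /= wcat_cons.
rewrite /=; case: eqP => [->|/eqP bw] /=; first exact: shift_ord_pred.
rewrite wcat0 /push; congr ([:: _] +++ _).
by case: b (nth _ _ _) bw => [] [].
Qed.

(** Removing [p] and the wrong letter after it leaves [shift j (omega w)], so
    that this letter stands at a position congruent to [ord_pred j], where
    [omega w] has the other letter. *)
Lemma shift_omega_branch (w : word) k (j : Zmod w) p :
  w <> [::] -> ~ proper_power w ->
  shift k (omega w) <> tail (Qd j p).
Proof.
move=> w0 wP e; rewrite /= in e.
have := congr1 (shift (size p)) e; rewrite shift_wcat shift_shift => {}e.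
have sj : j = (size p + k).+1 %[mod size w].
  apply: shift_omega_inj => //.
  by have := congr1 (shift 1) e; rewrite shift_shift shiftS_wcat shift0 wcat0 => <-.
have pj : ord_pred j = (size p + k) %[mod size w].
  have := ord_pred_modn j w0; rewrite sj => /eqP.
  by rewrite -(addn1 (ord_pred j)) -(addn1 (size p + k)) eqn_modDr => /eqP.
have := congr1 (fun f => f 0) e; rewrite /shift /omega add0n -pj modn_small ?ltn_Zmod //.
by rewrite /wcat /=; case: nth.
Qed.

(** If two tails of vertices [Qd] agree, then so do the positions of their wrong
    letters: the earlier one is followed by a periodic word, which contains no
    wrong letter. *)
Lemma tail_inj w : w <> [::] -> ~ proper_power w -> injective (@tail w).
Proof.
move=> w0 wP.
have cc (i j : Zmod w) : shift i (omega w) = shift j (omega w) -> i = j.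
  by move=> /(shift_omega_inj w0 wP); rewrite !modn_small ?ltn_Zmod // => /val_inj.
move=> [i|i p] [j|j q] e; first by rewrite (cc _ _ e).
- by case: (@shift_omega_branch w _ j q w0 wP e).
- by case: (@shift_omega_branch w _ i p w0 wP (esym e)).
move: e.
elim: p q => [|a p IHp] [|b q] /=; rewrite ?wcat0.
- by move=> /wcat_cons_inj[_]; rewrite !wcat0 => /cc ->.
- by move=> /wcat_cons_inj[_]; rewrite wcat0 => /(@shift_omega_branch w _ j q w0 wP).
- by move=> /esym/wcat_cons_inj[_]; rewrite wcat0 => /(@shift_omega_branch w _ i p w0 wP).
by move=> /wcat_cons_inj[-> /IHp[-> ->]].
Qed.

Lemma Qchild_inj w b b' (y y' : Qgrey w) : w <> [::] -> ~ proper_power w ->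
  Qchild b y = Qchild b' y' -> b = b' /\ y = y'.
Proof.
move=> w0 wP /(congr1 (@tail w)); rewrite !tail_child // => /wcat_cons_inj[-> e].
by split=> //; apply: (tail_inj w0 wP); rewrite !wcat0 in e.
Qed.

Lemma Qchild_c (w : word) (j : Zmod w) :
  Qchild (nth false w (ord_pred j)) (Qc j) = Qc (ord_pred j).
Proof. by rewrite /= eqxx. Qed.

Lemma Qchild_d (w : word) (j : Zmod w) :
  Qchild (~~ nth false w (ord_pred j)) (Qc j) = Qd j [::].
Proof. by rewrite /=; case: nth. Qed.

Lemma Qparent w (v : Qgrey w) : exists b v', v = Qchild b v'.
Proof.
case: v => [j|j [|b p]].
- by exists (nth false w (ord_pred (ordS j))), (Qc (ordS j)); rewrite Qchild_c ordSK.
- by exists (~~ nth false w (ord_pred j)), (Qc j); rewrite Qchild_d.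
by exists b, (Qd j p).
Qed.

Definition Qlabel (w : word) (y : Q w) : Xomega := rlabel (map_ray (@tail w) y).

Lemma Qlabel_inj w : w <> [::] -> ~ proper_power w -> injective (@Qlabel w).
Proof. by move=> w0 wP y z /rlabel_inj /map_ray_inj; apply; apply: tail_inj. Qed.

Lemma act_Qlabel w s (y : Q w) : w <> [::] ->
  act s (Qlabel y) = Qlabel (target (@Qchild w) s y).
Proof.
move=> w0; rewrite act_rlabel (@target_map _ _ (@Qchild w)) // => b v.
exact: tail_child.
Qed.

(** * Q(w) as a Schreier graph *)

(** Each vertex is joined to its grey vertex along a ray, [Qd j p] to [Qc j]
    through its ancestors, and [Qc j] to [Qc 0] along the cycle. *)
Lemma Qlabel_connected w (y z : Q w) : w <> [::] -> Defs.orbit (Qlabel y) (Qlabel z).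
Proof.
move=> w0.
pose R (y z : Q w) := Defs.orbit (Qlabel y) (Qlabel z).
have Rsym y1 y2 : R y1 y2 -> R y2 y1 := @orbit_sym _ _.
have Rtrans y1 y2 y3 : R y1 y2 -> R y2 y3 -> R y1 y3 := @orbit_trans _ _ _.
have Rt s y1 : R y1 (target (@Qchild w) s y1).
  by rewrite /R -act_Qlabel //; apply: orbit_act.
suff base y1 : R y1 (Grey (Qc ord0)) by apply: Rtrans (base y) (Rsym _ _ (base z)).
have ray (y2 : Q w) : R y2 (Grey (grey_of y2)).
  case: y2 => [v|v i|v i] /=; first exact: orbit_refl.
    elim: i => [|i IHi]; first exact: (Rt x0 (White v 0)).
    exact: Rtrans (Rt x0 (White v i.+1)) IHi.
  elim: i => [|i IHi]; first exact: Rsym (Rt x0 (Grey v)).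
  exact: Rtrans (Rsym _ _ (Rt x0 (Black v i))) IHi.
have Rchild b v : R (Grey (Qchild b v)) (Grey v).
  apply: (Rsym); case: b; last exact: (Rt x1 (Grey v)).
  exact: Rtrans (Rsym _ _ (ray (White v 0))) (Rt x1 (White v 0)).
have Rc k (j : Zmod w) : val j = k -> R (Grey (Qc j)) (Grey (Qc ord0)).
  elim: k j => [|k IHk] j jk.
    by rewrite (_ : j = ord0); [exact: orbit_refl | exact: val_inj].
  apply: (Rtrans _ (Grey (Qc (ord_pred j)))).
    by apply: (Rsym); rewrite -Qchild_c.
  apply: IHk; rewrite /= jk addSn /= modnDr modn_small //.
  by apply: ltnW; rewrite -jk ltn_ord.
apply: (Rtrans _ _ _ (ray y1)); case: (grey_of y1) => [j|j p]; first exact: Rc erefl.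
apply: (Rtrans _ (Grey (Qc j))); last exact: Rc erefl.
elim: p => [|b p IHp]; first by rewrite -Qchild_d.
exact: Rtrans (Rchild b (Qd j p)) IHp.
Qed.

Lemma sval_inj (A : Type) (P : A -> Prop) : injective (@proj1_sig A P).
Proof.
by move=> [a Pa] [b Pb] /= e; case: b / e Pb => Pb; rewrite (proof_irrelevance _ Pa Pb).
Qed.

Lemma injective_surjective_bijective (A B : Type) (f : A -> B) :
  injective f -> (forall b, exists a, f a = b) -> bijective f.
Proof.
move=> f_inj f_onto.
pose g b := proj1_sig (constructive_indefinite_description _ (f_onto b)).
have gK : cancel g f.
  by move=> b; rewrite /g; case: constructive_indefinite_description.
by exists g => // a; apply: f_inj; rewrite gK.
Qed.

(** Labels are stable under the generators and, as every vertex of [Q w] has an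
    incoming edge of each label, also under their inverses; hence the labels
    exhaust the orbit. *)
Lemma Qlabel_isomorphism w x (y0 : Q w) :
  w <> [::] -> ~ proper_power w -> Qlabel y0 = x ->
  exists phi : Q w -> schreier x,
    isomorphism phi /\ forall y, sval (phi y) = Qlabel y.
Proof.
move=> w0 wP y0x.
have orb (y : Q w) : Defs.orbit x (Qlabel y).
  by rewrite -y0x; exact: (Qlabel_connected y0 y w0).
exists (fun y => exist _ (Qlabel y) (orb y)); split=> //; split; last first.
  move=> s y z; rewrite ray_edgeE /= act_Qlabel //.
  by split=> [->//|/Qlabel_inj]; apply.
apply: injective_surjective_bijective => [y z [] /Qlabel_inj|[z Fz]]; first exact.
suff [y yz] : exists y : Q w, Qlabel y = z by exists y; apply: sval_inj.
apply: (orbit_invariant (P := fun u => exists y : Q w, Qlabel y = u) _ Fz).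
  move=> s u; split=> [[y <-]|[z' z'u]].
    by exists (target (@Qchild w) s y); rewrite act_Qlabel.
  have [y yz'] := target_onto s z' (@Qparent w); exists y.
  by apply: (@act_inj s); rewrite act_Qlabel // yz'.
by exists y0.
Qed.

(** * The standard form of a rational point *)

(** Each of the two lengths is a period of the common word, so divides the other. *)
Lemma omega_inj_primitive w w' :
  w <> [::] -> ~ proper_power w -> w' <> [::] -> ~ proper_power w' ->
  omega w = omega w' -> w = w'.
Proof.
move=> w0 wP w0' wP' e.
have dvd u u' : u <> [::] -> ~ proper_power u -> omega u = omega u' ->
    size u %| size u'.
  move=> u0 uP eu; apply: period_primitive => // n.
  by rewrite eu -(omega_period u' n 1) mul1n.
have sz : size w = size w' by apply/eqP; rewrite eqn_dvd !dvd.
apply: (@eq_from_nth _ false) => // i iw.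
have := congr1 (fun f => f i) e.
by rewrite /omega -sz modn_small.
Qed.

Lemma wcat_size a p u : ((a :: p) +++ u) (size p) = last a p.
Proof. by rewrite /wcat /= ltnSn (last_nth false). Qed.

(** A letter before the periodic part would be repeated one period of
    [omega w'] later, where the last letter of [w'] stands. *)
Lemma omega_preperiod w w' a v' : w <> [::] -> w' <> [::] ->
  omega w = (a :: v') +++ omega w' -> last a v' = last false w'.
Proof.
move=> w0 w0' e; rewrite -(wcat_size a v' (omega w')) -e.
have w_gt0 : 0 < size w by case: (w) w0.
have w_gt0' : 0 < size w' by case: (w') w0'.
rewrite -(omega_period w (size v') (size w')) e.
(* this position is the end of a copy of [w'] *)
have -> : size v' + size w' * size w
    = ((size w').-1 + (size w).-1 * size w') + size (a :: v').
  rewrite [size (a :: v')]/= addnS -addSn -addSn prednK // -mulSn prednK //.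
  by rewrite addnC mulnC.
rewrite -[LHS]/(shift (size (a :: v')) _ _) shift_wcat omega_period.
by rewrite /omega modn_small ?ltn_predL // nth_last.
Qed.

Lemma tail_form_unique v w v' w' :
  w <> [::] -> ~ proper_power w -> (v <> [::] -> last false v <> last false w) ->
  w' <> [::] -> ~ proper_power w' ->
  (v' <> [::] -> last false v' <> last false w') ->
  v +++ omega w = v' +++ omega w' -> v = v' /\ w = w'.
Proof.
move=> w0 wP + w0' wP'.
elim: v v' => [|a v IHv] [|a' v'] lv lv'; rewrite ?wcat0.
- by move/omega_inj_primitive ->.
- by move/omega_preperiod => /(_ w0 w0') /lv'; case.
- by move/esym/omega_preperiod => /(_ w0' w0) /lv; case.
have last_tail b u z : (b :: u <> [::] -> last false (b :: u) <> last false z) ->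
    u <> [::] -> last false u <> last false z.
  by case: u => // c u h _; apply: h.
move=> /wcat_cons_inj[-> /IHv]; case; [exact: last_tail lv|exact: last_tail lv'|].
by move=> -> ->.
Qed.

Lemma standard_form_unique x t t' :
  standard_form x t -> standard_form x t' -> t = t'.
Proof.
case: t t' => [[[b n] v] w] [[[b' n'] v'] w'].
case=> n_gt0 xE w0 wP lv [n_gt0' xE' w0' wP' lv'].
rewrite xE in xE'; have [-> -> e] := nseq_run_inj xE' n_gt0 n_gt0'.
by have [-> ->] := tail_form_unique w0 wP lv w0' wP' lv' e.
Qed.

Lemma least_nat (P : nat -> Prop) :
  (exists n, P n) -> exists2 n, P n & forall m, P m -> n <= m.
Proof.
case=> n; elim/ltn_ind: n => n IHn Pn.
case: (classic (exists2 m, m < n & P m)) => [[m /IHn]|nP]; first exact.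
by exists n => // m Pm; rewrite leqNgt; apply/negP => mn; apply: nP; exists m.
Qed.

Lemma wcat_mkseq u n : u = mkseq u n +++ shift n u.
Proof.
apply: functional_extensionality => i; rewrite /wcat size_mkseq.
by case: ltnP => ni; rewrite ?nth_mkseq // /shift subnK.
Qed.

Lemma first_run x : x <> constw (x 0) ->
  exists n u, 0 < n /\ x = nseq n (x 0) +++ [:: ~~ x 0] +++ u.
Proof.
move=> xc.
have /least_nat[n nx minn] : exists n, x n <> x 0.
  apply: NNPP => nex; apply: xc; apply: functional_extensionality => n.
  by apply: NNPP => nx; apply: nex; exists n.
exists n, (shift 1 (shift n x)); split; first by case: n nx {minn}.
rewrite {1}(wcat_mkseq x n) {1}[shift n x]wcat_head; congr (_ +++ [:: _] +++ _).
  apply: (@eq_from_nth _ false) => [|i]; rewrite size_mkseq ?size_nseq // => ilt.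
  rewrite nth_mkseq // nth_nseq ilt; apply: NNPP => /minn.
  by rewrite leqNgt ilt.
by rewrite /shift add0n; case: (x n) (x 0) nx => [] [].
Qed.

Lemma rational_shift x k : rational x -> rational (shift k x).
Proof.
case=> N [p [p0 px]]; exists N, p; split=> // n Nn.
by rewrite /shift addnAC px // (leq_trans Nn) // leq_addr.
Qed.

(** Least preperiod first, then least period: minimality of the former makes
    the last letters differ, minimality of the latter makes [w] primitive. *)
Lemma tail_form_exists u : rational u ->
  exists v w, [/\ u = v +++ omega w, w <> [::], ~ proper_power w
    & v <> [::] -> last false v <> last false w].
Proof.
move=> /least_nat[N [p0 [p0_gt0 up0]] minN].
have /least_nat[p [p_gt0 up] minp] : exists p, 0 < p /\ forall n, N <= n -> u (n + p) = u n.
  by exists p0.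
have uE : u = mkseq u N +++ omega (mkseq (shift N u) p).
  rewrite {1}(wcat_mkseq u N); congr (_ +++ _).
  apply: functional_extensionality => n; rewrite /omega size_mkseq.
  rewrite nth_mkseq ?ltn_mod // {1}(divn_eq n p) addnC.
  rewrite (@period_iter (shift N u) p) // => m.
  by rewrite /shift addnAC up // leq_addl.
exists (mkseq u N), (mkseq (shift N u) p); split=> //.
- by case: (p) p_gt0.
- case=> z [k [k1 zE]].
  have pE : p = k * size z.
    by rewrite -[LHS](size_mkseq (shift N u)) zE size_flatten /shape map_nseq sumn_nseq mulnC.
  have z_gt0 : 0 < size z by move: p_gt0; rewrite pE muln_gt0 => /andP[].
  suff : p <= size z by rewrite pE leqNgt ltn_Pmull.
  apply: minp; split=> // n Nn.
  rewrite uE /wcat size_mkseq !ltnNge Nn (leq_trans Nn (leq_addr _ _)) /= -addnBAC //.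
  (* if [w] is a power of [z], then [size z] is a period of [u] after [N] *)
  have zo m : omega (mkseq (shift N u) p) m = nth false z (m %% size z).
    rewrite /omega size_mkseq zE nth_power -?pE ?ltn_mod //.
    by rewrite modn_dvdm // pE dvdn_mull.
  by rewrite !zo modnDr.
(* equal last letters would extend the period one place to the left *)
case: N minN {up0 uE minp} up => // N minN up _ lastE.
suff /minN : exists p, 0 < p /\ forall n, N <= n -> u (n + p) = u n by rewrite ltnn.
exists p; split=> // n; rewrite leq_eqVlt => /orP[/eqP <-|/up //].
move: lastE; rewrite -!nth_last !size_mkseq !nth_mkseq ?ltn_predL //=.
by rewrite /shift addnS -addSn prednK // addnC => ->.
Qed.

Lemma standard_form_exists x :
  rational x -> x <> constw false -> x <> constw true ->
  exists t, standard_form x t.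
Proof.
move=> xr x0 x1.
have [|n [u [n_gt0 xE]]] := @first_run x; first by case: (x 0).
have [|v [w [uE w0 wP lv]]] := @tail_form_exists u.
  have := rational_shift (size (nseq n (x 0) ++ [:: ~~ x 0])) xr.
  by rewrite {3}xE -wcat_cat shift_wcat.
by exists (x 0, n, v, w); split; rewrite // -uE.
Qed.

(** * Transport along isomorphisms *)

Lemma isomorphism_inverse (G K : lgraph) (f : G -> K) : isomorphism f ->
  exists g : K -> G, [/\ isomorphism g, cancel f g & cancel g f].
Proof.
case=> -[g fK gK] fE; exists g; split=> //.
by split=> [|s y z]; [exists f | rewrite fE !gK].
Qed.

Lemma hanging_isomorphism (G G' K : lgraph) (phi : G -> G') (r : K) f :
  isomorphism phi -> hanging r f -> hanging r (phi \o f).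
Proof.
move=> phi_iso [f_inj fE fr].
have [psi [[_ psiE] phiK psiK]] := isomorphism_inverse phi_iso.
case: phi_iso => _ phiE; split.
- exact: inj_comp (can_inj phiK) f_inj.
- by move=> s k l; rewrite /= -phiE.
move=> k y yf ky; apply: (fr k (psi y)) => [l /(congr1 phi)|].
  by rewrite psiK; exact: yf.
by case: ky => s ky; exists s; rewrite -[f k]phiK -!psiE.
Qed.

Lemma walk_map (G K : lgraph) (f : G -> K) y ts z :
  (forall s y z, edge s y z -> edge s (f y) (f z)) -> walk y ts z ->
  walk (f y) [seq (t.1, f t.2) | t <- ts] (f z).
Proof.
move=> fE; elim: ts y => [|[[s fwd] y'] ts IHts] y /=; first by move->.
by case=> e /IHts; split=> //; case: fwd e => /fE.
Qed.

Lemma geodesic_ray_isomorphism (G G' : lgraph) (phi : G -> G') r :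
  isomorphism phi -> geodesic_ray r -> geodesic_ray (phi \o r).
Proof.
move=> phi_iso [r0 r1 rg].
have [psi [[_ psiE] phiK _]] := isomorphism_inverse phi_iso.
case: phi_iso => _ phiE; split=> [i|i|i j ts ij]; try exact/phiE.
move=> /(walk_map (fun s y z => proj1 (psiE s y z))) /=.
by rewrite !phiK => /(rg i j _ ij); rewrite size_map.
Qed.

(** * Hanging subgraphs of graphs with attached rays *)

(** Each vertex has exactly one outgoing edge per label, so an injective
    map which preserves edges can only fail to reflect them, or to be closed
    under neighbors, where an edge leaves the image; this is allowed at the root
    alone. *)
Lemma hanging_attach_rays T (child : bool -> T -> T) (K : lgraph) (r : K)
    (f : K -> attach_rays child) :
  injective f ->
  (forall s k l, edge s k l -> target child s (f k) = f l) ->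
  (forall s k, (exists l, edge s k l /\ target child s (f k) = f l) \/
     k = r /\ forall l, f l <> target child s (f k)) ->
  (forall s k y, target child s y = f k -> (exists l, f l = y) \/ k = r) ->
  hanging r f.
Proof.
move=> f_inj fE f_out f_in; split=> // [s k l|k y yf].
  rewrite ray_edgeE; split=> [/fE //|e].
  case: (f_out s k) => [[l' [kl']]|[_ /(_ l)]]; last by rewrite e.
  by rewrite e => /f_inj ->.
case=> s []; rewrite ray_edgeE => e; last by case: (f_in s k y e) => // -[l /yf].
by case: (f_out s k) => [[l [_]]|[]] //; rewrite e => /esym/yf.
Qed.

Definition descendant (T : Type) (child : bool -> T -> T) (v : T) (p : word) : T :=
  foldr child v p.

Lemma descendant_target T (child : bool -> T -> T) v s y :
  target child s (map_ray (descendant child v) y) =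
  map_ray (descendant child v) (target Hchild s y).
Proof. exact: target_map. Qed.

Lemma descendant_d (w : word) (j : Zmod w) p q :
  descendant (@Qchild w) (Qd j p) q = Qd j (q ++ p).
Proof. by elim: q => //= b q ->. Qed.

Lemma Qchild_eq_d (w : word) b (v : Qgrey w) j a p :
  Qchild b v = Qd j (a :: p) -> v = Qd j p.
Proof. by case: v => [i|i q] /=; [case: ifP | case=> -> _ ->]. Qed.

Lemma target_inv T (child : bool -> T -> T) s y z : target child s y = z ->
  grey_of y = grey_of z \/
  exists b v, [/\ s = x1, z = Grey (child b v) & y = if b then White v 0 else Grey v].
Proof.
move=> <-; case: s y => [] [v|v [|i]|v i] /=; auto; right.
  by exists false, v.
by exists true, v.
Qed.

Lemma map_ray_grey T T' (g : T -> T') y v : grey_of y = g v ->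
  exists2 l, map_ray g l = y & grey_of l = v.
Proof.
case: y => [u|u i|u i] /= ->; by [exists (Grey v) | exists (White v i) | exists (Black v i)].
Qed.

Lemma cat_inj_l (q q' p : word) : q ++ p = q' ++ p -> q = q'.
Proof.
move=> e; have qq' : size q = size q'.
  by apply/eqP; rewrite -(eqn_add2r (size p)) -!size_cat e.
by move/eqP: e; rewrite eqseq_cat // eqxx andbT => /eqP.
Qed.

Lemma H_hanging_Qd (w : word) (j : Zmod w) (p : word) :
  @hanging (Q w) H Hroot (map_ray (descendant (@Qchild w) (Qd j p))).
Proof.
apply: hanging_attach_rays => [|s k l|s k|s k y /target_inv].
- by apply: map_ray_inj => q q'; rewrite !descendant_d; case=> e; apply: cat_inj_l e.
- by rewrite ray_edgeE descendant_target => ->.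
- by left; exists (target Hchild s k); rewrite ray_edgeE descendant_target.
rewrite grey_of_map; case=> [e|[b [v [_]]]].
  by have [l yl _] := map_ray_grey e; left; exists l.
case: k => // -[|c q] /= [e yE]; first by right.
move: e; rewrite descendant_d => /esym/Qchild_eq_d vE.
by left; exists (if b then White q 0 else Grey q); rewrite yE; case: b {yE} => /=;
  rewrite descendant_d -vE.
Qed.

Lemma hanging_isomorphism_r (G K K' : lgraph) (psi : K -> K') r f :
  isomorphism psi -> hanging r f ->
  exists f' : K' -> G, hanging (psi r) f' /\ f' (psi r) = f r.
Proof.
move=> psi_iso [f_inj fE fr].
have [phi [[_ phiE] psiK phiK]] := isomorphism_inverse psi_iso.
exists (f \o phi); split=> /=; last by rewrite psiK.
split=> [|s k l|k y yf ky].
- exact: inj_comp f_inj (can_inj phiK).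
- by rewrite phiE fE.
- by rewrite -(fr (phi k) y) // => l ly; apply: (yf (psi l)); rewrite /= psiK.
Qed.

(** Appending the letter 0 to the words of [H] turns it into [Hr], so that [Hr]
    hangs wherever [H] does. *)
Lemma Hr_isomorphism : exists psi : H -> Hr, isomorphism psi /\ psi Hroot = Hr_root.
Proof.
have Hr_lift (k : H) : in_Hr (map_ray (rcons^~ false) k).
  by rewrite /in_Hr grey_of_map; exists (grey_of k).
have g_inj : injective (map_ray (rcons^~ false)).
  by apply: map_ray_inj => q q' /rcons_inj[].
exists (fun k => exist in_Hr _ (Hr_lift k)); split; last exact: sval_inj.
split; first apply: injective_surjective_bijective.
- by move=> k l [] /g_inj.
- move=> [k Hk]; have [q kq] := Hk.
  have [l lk _] := map_ray_grey (g := rcons^~ false) kq.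
  by exists l; apply: sval_inj.
move=> s y z; rewrite ray_edgeE.
rewrite -[edge s _ _]/(edge (l := H) s (map_ray _ y) (map_ray _ z)) ray_edgeE.
by rewrite (target_map (child := Hchild)) //; split=> [->|/g_inj].
Qed.

Lemma Hr_hanging_Qd (w : word) (j : Zmod w) (p : word) :
  exists f : Hr -> Q w, hanging Hr_root f /\ f Hr_root = Grey (Qd j p).
Proof.
have [psi [psi_iso <-]] := Hr_isomorphism.
exact: hanging_isomorphism_r psi_iso (H_hanging_Qd j p).
Qed.

Lemma Qchild_eq_d0 (w : word) b (v : Qgrey w) j :
  Qchild b v = Qd j [::] -> v = Qc j /\ b = ~~ nth false w (ord_pred j).
Proof.
case: v => [i|i q] //=; case: eqP => // /eqP bw [<-]; split=> //.
by case: b (nth _ _ _) bw => [] [].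
Qed.

(** If the cycle leaves [Qc j] by its right child, then the left child of
    [Qc j] is [Qd j [::]], and what lies under it is reached from
    [a_1] of [Qc j] only.  The map taking [p] to a descendant of [Qc j] is not
    injective on words (going around the cycle it returns to [Qc j]) but it is
    on those ending in the letter 1. *)
Lemma Hl_hanging_Qc (w : word) (j : Zmod w) : nth false w (ord_pred j) = false ->
  exists f : Hl -> Q w, hanging Hl_root f /\ f Hl_root = White (Qc j) 0.
Proof.
move=> wj; set F := map_ray (descendant (@Qchild w) (Qc j)).
have gE q : descendant (@Qchild w) (Qc j) (rcons q true) = Qd j q.
  rewrite /descendant foldr_rcons /= wj /=.
  by rewrite -[LHS]/(descendant _ _ _) descendant_d cats0.
exists (F \o sval); split=> //; apply: hanging_attach_rays => /=.
- move=> [k Pk] [l Pl] /= e; apply: sval_inj => /=.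
  case: Pk Pl e => [[i ->]|[q kq]] [[i' ->]|[q' lq]] e; first by case: e => ->.
  + by have := congr1 (@grey_of _) e; rewrite !grey_of_map lq gE.
  + by have := congr1 (@grey_of _) e; rewrite !grey_of_map kq gE.
  apply: (map_ray_inj_at e); have := congr1 (@grey_of _) e.
  by rewrite !grey_of_map kq lq !gE => -[->].
- by move=> s [k Pk] [l Pl] /(@ray_edgeE _ Hchild s k l) /= <-; rewrite descendant_target.
- move=> s [k Pk].
  suff [Pt|[-> k0]] : in_Hl (target Hchild s k) \/ s = x0 /\ k = White [::] 0.
  + by left; exists (exist in_Hl _ Pt); split; [exact/ray_edgeE | exact: descendant_target].
  + right; split=> [|[l Pl]]; [exact: sval_inj | rewrite /= k0].
    case: Pl => [[i ->]|[q lq]] //= e.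
    by have := congr1 (@grey_of _) e; rewrite !grey_of_map lq gE.
  case: Pk => [[[|i] ->]|[q kq]].
  + by case: s; [right | left; right; exists [::]].
  + by left; left; exists i; case: s.
  left; right; rewrite /=.
  have [<-|] := target_inv (erefl (target Hchild s k)); first by exists q.
  case=> b [v [_ -> kE]]; exists (b :: q); rewrite kE in kq.
  by move: kq => /=; case: (b) => /= ->.
move=> s [k Pk] y /= yk.
suff [[l Pl ly]|k0] : (exists2 l, in_Hl l & F l = y) \/ k = White [::] 0.
- by left; exists (exist _ l Pl).
- by right; apply: sval_inj.
case: Pk yk => [[i ->]|[q kq]] yk.
  left; exists (White [::] i.+1); first by left; exists i.+1.
  by case: s y yk => [] [v|v [|i']|v i'] //= [-> ->].
left; have [] := target_inv yk; rewrite {1}/F ?grey_of_map ?kq.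
  move=> e; have [l ly lq] := map_ray_grey e.
  by exists l => //; right; exists q.
case=> b [v [_ kE yE]]; rewrite yE.
have := congr1 (@grey_of _) kE; rewrite /F grey_of_map kq gE /=.
case: q kq => [|c q] _ /esym.
  move=> /Qchild_eq_d0[-> ->]; rewrite wj.
  by exists (White [::] 0) => //; left; exists 0.
move=> /Qchild_eq_d ->.
exists (if b then White (rcons q true) 0 else Grey (rcons q true)).
  by right; exists q; case: (b).
by case: (b); rewrite /= gE.
Qed.

(** * Black rays *)

Definition black_rank (T : Type) (y : ray_vertex T) : nat :=
  if y is Black _ i then i.+1 else 0.

Lemma black_rank_lipschitz T (child : bool -> T -> T) (y z : attach_rays child) :
  adjacent y z -> black_rank z <= (black_rank y).+1.
Proof.
case=> s []; rewrite ray_edgeE => <-.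
  by case: s y => [] [v|v [|i]|v i] //=; rewrite !ltnS ?leqW.
by case: s z => [] [v|v [|i]|v i] //=; rewrite !ltnS ?leqW.
Qed.

(** One edge changes the rank by at most one. *)
Lemma black_rank_walk T (child : bool -> T -> T) (y z : attach_rays child) ts :
  walk y ts z -> black_rank z <= black_rank y + size ts.
Proof.
elim: ts y => [|[[s fwd] y'] ts IHts] y /=; first by move->; rewrite addn0.
case=> yy' /IHts zy'; rewrite addnS -addSn (leq_trans zy') // leq_add2r.
by apply: black_rank_lipschitz; exists s; case: fwd yy'; auto.
Qed.

(** The ray starts at [v] itself when [k = 0]; [v] then carries a loop labeled
    [x1] exactly if it is its own right child. *)
Lemma black_ray_edge T (child : bool -> T -> T) v k s i j :
  0 < k \/ child false v = v ->
  edge (l := attach_rays child) s (vb v (i + k)) (vb v (j + k)) <->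
  if s is x0 then j = i.+1 else j = i.
Proof.
move=> kv; rewrite ray_edgeE.
have vb_inj m n : vb v m = vb v n -> m = n by case: m n => [|m] [|n] //= [->].
have -> : target child s (vb v (i + k)) = vb v (if s is x0 then (i + k).+1 else i + k).
  case: s; case ik : (i + k) => [|m] //=.
  by case: kv => [k_gt0|-> //]; have := ltn_addl i k_gt0; rewrite ik.
case: s; split=> [/vb_inj|->] //; first by rewrite -addSn => /addIn.
by move/addIn.
Qed.

Lemma black_ray_geodesic T (child : bool -> T -> T) v k :
  0 < k \/ child false v = v ->
  geodesic_ray (G := attach_rays child) (fun i => vb v (i + k)).
Proof.
move=> kv; split=> [i|i|i j ts ij]; try exact/(black_ray_edge _ _ _ kv).
move/black_rank_walk; have rk m : black_rank (vb v m) = m by case: m.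
by rewrite !rk leq_subLR addnAC leq_add2r.
Qed.

(** * Upward walks and the nontrivial loop *)

Lemma upward_walk_cat T (child : bool -> T -> T) y p z q t :
  upward_walk child y p z -> upward_walk child z q t ->
  upward_walk child y (p ++ q) t.
Proof. by elim: p y => [|[b y'] p IHp] y /= => [-> //|[-> /IHp]] h /h. Qed.

Lemma upward_walk_end T (child : bool -> T -> T) y m p z :
  upward_walk child y (m :: p) z -> List.In z (unzip2 (m :: p)).
Proof.
case: m => b y' /= [_]; elim: p b y y' => [|[c y2] p IHp] b y y' /=; first by left.
by case=> _ /(IHp c y')[->|]; auto.
Qed.

(** A vertex determines its parent, so one of two upward walks extends the other;
    as both end at [z], a proper extension would meet [z] twice. *)
Lemma upward_path_unique T (child : bool -> T -> T) y p p' z :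
  (forall b b' v v', child b v = child b' v' -> b = b' /\ v = v') ->
  upward_path child y p z -> upward_path child y p' z -> p' = p.
Proof.
move=> child_inj; rewrite /upward_path.
elim: p y p' => [|[b v] p IHp] y [|[b' v'] p'] //.
- move=> [yz _] [w np]; have := upward_walk_end w; rewrite -yz => yp.
  by case/List.NoDup_cons_iff: np.
- move=> [w np] [yz _]; have := upward_walk_end w; rewrite -yz => yp.
  by case/List.NoDup_cons_iff: np.
move=> /= [[-> wp] /List.NoDup_cons_iff[_ np]].
move=> [[/child_inj[<- <-] wp'] /List.NoDup_cons_iff[_ np']].
by congr cons; apply: (IHp v).
Qed.

Section Climb.

Variables (T : Type) (child : bool -> T -> T).
Implicit Types (p q : seq (bool * T)).

Lemma climb_cat p q : climb child (p ++ q) = climb child p ++ climb child q.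
Proof. by rewrite /climb map_cat flatten_cat. Qed.

Lemma climb_walk y p z : upward_walk child y p z ->
  walk (Grey y : attach_rays child) (climb child p) (Grey z).
Proof.
elim: p y => [|[b y'] p IHp] y /= => [-> //|[-> /IHp w]].
case: b => /=; first by split; [exact: e1_left | split=> //; exact: (e0_a child y' 0)].
by split=> //; exact: e1_right.
Qed.

Lemma visited_grey p y :
  List.In y (visited (climb child p)) -> List.In (grey_of y) (unzip2 p).
Proof.
elim: p => [|[[] v] p IHp] //=; first by case=> [<-|[<-|/IHp]]; auto.
by case=> [<-|/IHp]; auto.
Qed.

Lemma visited_climb p b v : List.In (b, v) p ->
  List.In (Grey v : attach_rays child) (visited (climb child p)) /\
  (b -> List.In (White v 0 : attach_rays child) (visited (climb child p))).
Proof.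
elim: p => [|[c u] p IHp] //= [[-> ->]|/IHp[g w]]; first by case: b {IHp} => /=; split; auto.
by case: c => /=; split; auto.
Qed.

Lemma visited_NoDup p : List.NoDup (unzip2 p) -> List.NoDup (visited (climb child p)).
Proof.
elim: p => [|[b v] p IHp] /=; first by constructor.
case/List.NoDup_cons_iff=> vp /IHp np.
case: b => /=; repeat constructor=> //; try by move/visited_grey.
by case=> [|/visited_grey].
Qed.

(** An edge of a climb starts at the grey vertex reached or at the white vertex
    next to it, so a climb repeats no edge unless it repeats a vertex. *)
Lemma edges_grey p y e :
  List.In e (edges (Grey y : attach_rays child) (climb child p)) ->
  List.In (grey_of e.1.2) (unzip2 p).
Proof.
elim: p y => [|[[] v] p IHp] y //=; first by case=> [<-|[<-|/IHp]]; auto.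
by case=> [<-|/IHp]; auto.
Qed.

Lemma edges_NoDup y p : List.NoDup (unzip2 p) ->
  List.NoDup (edges (Grey y : attach_rays child) (climb child p)).
Proof.
elim: p y => [|[b v] p IHp] y /=; first by constructor.
case/List.NoDup_cons_iff=> vp /IHp np.
case: b => /=; repeat constructor=> //; try by move/edges_grey.
by case=> [|/edges_grey].
Qed.

Lemma climb_loop y p : p <> [::] -> upward_walk child y p y ->
  List.NoDup (unzip2 p) ->
  loop (Grey y : attach_rays child) (climb child p).
Proof.
move=> p0 wp np; split; [|exact: climb_walk|exact: visited_NoDup|exact: edges_NoDup].
by case: p p0 {wp np} => [|[[] v] p].
Qed.

End Climb.

(** The way up from [10vw^omega] to [10w^omega]. *)
Fixpoint ascent (v w : word) : seq (bool * Qgrey w) :=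
  if v is a :: v' then (a, Qgamma v' w) :: ascent v' w else [::].

(** The way up along the cycle, from [Qc 0] to [Qc (size w).-1]. *)
Definition around (w : word) : seq (bool * Qgrey w) :=
  [seq (nth false w i, Qc (inord i.+1)) | i <- iota 0 (size w).-1].

(** The last move leads from [Qc (size w).-1] to its parent [Qc 0]. *)
Definition around_loop (w : word) : seq (bool * Qgrey w) :=
  around w ++ [:: (last false w, Qc ord0)].

Lemma ord_pred0 (w : word) : ord_pred (ord0 : Zmod w) = ord_max.
Proof. by apply: val_inj; rewrite /= modn_small. Qed.

Lemma ord_pred_inord (w : word) i : i < (size w).-1 ->
  ord_pred (inord i.+1 : Zmod w) = inord i.
Proof.
move=> iw; apply: val_inj => /=; rewrite !inordK ?ltnS // 1?ltnW //.
by rewrite addSn /= modnDr modn_small // ltnS ltnW.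
Qed.

Lemma nth_ord_pred0 (w : word) :
  nth false w (ord_pred (ord0 : Zmod w)) = last false w.
Proof. by rewrite ord_pred0 nth_last. Qed.

Lemma ascent_walk v w : (v <> [::] -> last false v <> last false w) ->
  upward_walk (@Qchild w) (Qgamma v w) (ascent v w) (Qc ord0).
Proof.
elim: v => //= a [|b v] IHv lv; split=> //; last by apply: IHv => _; apply: lv.
rewrite -Qchild_d nth_ord_pred0; congr (Qchild _ _).
have {lv} : a <> last false w by apply: lv.
by case: a (last _ _) => [] [].
Qed.

Lemma unzip1_ascent v w : unzip1 (ascent v w) = v.
Proof. by elim: v => //= a v ->. Qed.

Lemma around_walk w : upward_walk (@Qchild w) (Qc ord0) (around w) (Qc ord_max).
Proof.
have -> : Qc ord0 = Qc (inord 0) :> Qgrey w.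
  by congr Qc; apply: val_inj; rewrite /= inordK.
have -> : Qc ord_max = Qc (inord (0 + (size w).-1)) :> Qgrey w.
  by congr Qc; apply: val_inj; rewrite /= inordK.
suff walk_iota n i : i + n <= (size w).-1 ->
    upward_walk (@Qchild w) (Qc (inord i))
      [seq (nth false w k, Qc (inord k.+1)) | k <- iota i n] (Qc (inord (i + n))).
  exact: walk_iota.
elim: n i => [|n IHn] i; rewrite ?addn0 // addnS => iw.
have iw' : i < (size w).-1 by apply: leq_trans iw; rewrite ltnS leq_addr.
split; [rewrite -[LHS]/(Qc (inord i)) | by rewrite -addSn; apply: IHn].
have := Qchild_c (inord i.+1 : Zmod w); rewrite ord_pred_inord // inordK.
  by move->.
exact: ltnW.
Qed.

Lemma unzip1_around w : unzip1 (around w) = take (size w).-1 w.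
Proof.
by rewrite /unzip1 /around -map_comp -(map_nth_iota0 false) ?leq_pred.
Qed.

Lemma around_loop_walk w :
  upward_walk (@Qchild w) (Qc ord0) (around_loop w) (Qc ord0).
Proof.
apply: upward_walk_cat (@around_walk w) _; split=> //.
by rewrite -nth_ord_pred0 Qchild_c ord_pred0.
Qed.

Lemma NoDup_map_inj (T : eqType) (U : Type) (f : T -> U) s :
  uniq s -> {in s &, injective f} -> List.NoDup (map f s).
Proof.
elim: s => [|a s IHs] /=; first by constructor.
move=> /andP[as_ us] f_inj; constructor; last first.
  by apply: IHs => // b c bs cs; apply: f_inj; rewrite inE ?bs ?cs orbT.
suff im l : {subset l <= s} -> ~ List.In (f a) (map f l) by exact: im.
elim: l => [_ []|b l IHl bl /= [fba|]]; last first.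
  by apply: IHl => c cl; apply: bl; rewrite inE cl orbT.
have bs : b \in s by apply: bl; rewrite mem_head.
have ba : b = a by apply: f_inj => //; rewrite inE ?bs ?eqxx ?orbT.
by rewrite -ba bs in as_.
Qed.

Lemma around_NoDup w : List.NoDup (Qc ord0 :: unzip2 (around w)).
Proof.
have -> : Qc ord0 :: unzip2 (around w)
    = [seq Qc (inord i) | i <- iota 0 (size w).-1.+1] :> seq (Qgrey w).
  rewrite /= -[1]addn0 iotaDl /unzip2 /around -!map_comp; congr (Qc _ :: _).
  by apply: val_inj; rewrite /= inordK.
apply: NoDup_map_inj => [|i j]; first exact: iota_uniq.
rewrite !mem_iota !add0n => iw jw [] /(congr1 val).
by rewrite /= !inordK.
Qed.

Lemma around_loop_NoDup w : List.NoDup (unzip2 (around_loop w)).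
Proof.
have := List.NoDup_Add (List.Add_app (Qc ord0) (unzip2 (around w)) [::]).
rewrite List.app_nil_r /unzip2 map_cat => -[_]; apply.
by have /List.NoDup_cons_iff[] := @around_NoDup w.
Qed.

Lemma mem_around_loop (w : word) (j : Zmod w) :
  List.In (nth false w (ord_pred j), Qc j) (around_loop w).
Proof.
apply: List.in_or_app; have [->|j0] := eqVneq j ord0.
  by right; left; rewrite nth_ord_pred0.
left; have j_gt0 : 0 < j by rewrite lt0n; apply: contra_neq j0 => j0; apply: val_inj.
have jw : j.-1 < (size w).-1 by rewrite -ltnS (prednK j_gt0) ltn_ord.
have jE : inord (j.-1).+1 = j by rewrite (prednK j_gt0) inord_val.
move: (nat_of_ord j).-1 jw jE => k kw <-; rewrite ord_pred_inord // inordK; last exact: ltnW.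
suff im l : k \in l -> List.In (nth false w k, Qc (inord k.+1))
    [seq (nth false w i, Qc (inord i.+1 : Zmod w)) | i <- l].
  by apply: im; rewrite mem_iota.
by elim: l => //= i l IHl; rewrite inE => /orP[/eqP <-|/IHl]; auto.
Qed.

Lemma In_around_loop w g : List.In g (unzip2 (around_loop w)) -> exists j : Zmod w, g = Qc j.
Proof.
rewrite /unzip2 map_cat => gc; case: (List.in_app_or _ _ _ gc) => [|[<-|[]]]; last first.
  by exists ord0.
by rewrite /around; elim: iota => //= i l IHl [<-|/IHl //]; exists (inord i.+1).
Qed.

(** The vertices on the way up to [Qc ord0] lie at decreasing distance from
    the cycle of the [Qc j]. *)
Lemma ascent_NoDup v w cs : List.NoDup (Qc ord0 :: cs) ->
  (forall g, List.In g cs -> exists j : Zmod w, g = Qc j) ->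
  List.NoDup (Qgamma v w :: unzip2 (ascent v w) ++ cs).
Proof.
move=> ncs csE; pose depth (g : Qgrey w) := if g is Qd _ p then (size p).+1 else 0.
have dg u : depth (Qgamma u w) = size u by case: u => [|a u] //=; rewrite size_belast.
have dp u g : List.In g (Qgamma u w :: unzip2 (ascent u w) ++ cs) -> depth g <= size u.
  elim: u => [|a u IHu]; first by case=> [<- //|/csE[j ->]].
  by case=> [<-|/IHu/leqW //]; rewrite dg.
elim: v => [|a v IHv] //; constructor=> //.
by move/(dp v); rewrite dg ltnn.
Qed.

Lemma ascent_around_path v w : (v <> [::] -> last false v <> last false w) ->
  upward_path (@Qchild w) (Qgamma v w) (ascent v w ++ around w) (Qc ord_max).
Proof.
move=> lv; split; first exact: upward_walk_cat (ascent_walk lv) (@around_walk w).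
rewrite /unzip2 map_cat; apply: ascent_NoDup (@around_NoDup w) _ => g gc.
by apply: In_around_loop; rewrite /unzip2 map_cat; apply: List.in_or_app; left.
Qed.

Lemma Qchild_eq_c (w : word) b (v : Qgrey w) j :
  Qchild b v = Qc j -> exists2 i, v = Qc i & b = nth false w (ord_pred i).
Proof. by case: v => [i|//] /=; case: eqP => // -> _; exists i. Qed.

(** The loop runs through every [Qc j], and through its white neighbor exactly
    when [Qc (ord_pred j)] is its left child.  So the neighbors off the loop are
    the black one and those on the side of the other child. *)
Lemma around_loop_neighbor (w : word) (g : Qgrey w) (y : Q w) :
  let visited_loop := visited (climb (@Qchild w) (around_loop w)) in
  List.In (Grey g : Q w) visited_loop -> adjacent (Grey g : Q w) y ->
  ~ List.In y visited_loop ->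
  exists j : Zmod w,
    [\/ y = Black (Qc j) 0,
        nth false w (ord_pred j) = false /\ y = White (Qc j) 0
      | y = Grey (Qd j [::])].
Proof.
move=> vl /visited_grey /In_around_loop[j /= ->] jy yl; exists j.
have cl i := visited_climb (@Qchild w) (@mem_around_loop w i).
case: jy => s []; rewrite ray_edgeE => e.
  case: s e => e; first by constructor 1.
  move: yl; rewrite -e /=; case: eqP => [_|_] yl; last by constructor 3.
  by case: (yl (proj1 (cl _))).
have [gy|[b [v [_ [/esym/Qchild_eq_c[i -> bi]] yE]]]] := target_inv e; last first.
  by case: yl; rewrite yE; case: b bi {yE} => bi; apply cl.
case: y e gy yl => [v|v [|i]|v i] e /= gy yl; rewrite gy in e yl *.
- by case: (yl (proj1 (cl j))).
- case wj: (nth false w (ord_pred j)); last by constructor 2.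
  by case: yl; apply: (proj2 (cl j)).
- by case: s e.
- by case: s e.
Qed.

(** Climbing from [Qc (size w).-1] to its parent [Qc 0] takes one edge or passes
    through [110w^omega], as the last letter of [w] is 0 or 1. *)
Lemma around_loop_climb w :
  climb (@Qchild w) (around_loop w) = climb (@Qchild w) (around w) ++
    (if last false w then [:: (x1, false, White (Qc ord0) 0); (x0, true, Grey (Qc ord0))]
     else [:: (x1, false, Grey (Qc ord0))]).
Proof. by rewrite /around_loop climb_cat {2}/climb /=; case: last. Qed.

(** * The graph of one half *)

Lemma omega_false : omega [:: false] = constw false.
Proof. by apply: functional_extensionality => n; rewrite /omega modn1. Qed.

Lemma constw_cons b : [:: b] +++ constw b = constw b.
Proof. by apply: functional_extensionality => -[]. Qed.

Lemma shift_constw k b : shift k (constw b) = constw b.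
Proof. by []. Qed.

Lemma letter_primitive b : ~ proper_power [:: b].
Proof.
case=> u [k [k_gt1]] /(congr1 size); rewrite size_flatten /shape map_nseq sumn_nseq.
by move/esym/eqP; rewrite muln_eq1 => /andP[_ /eqP k1]; rewrite k1 in k_gt1.
Qed.

Definition half_grey : Qgrey [:: false] := Qc ord0.

Lemma tail_half : tail half_grey = constw false.
Proof. by rewrite /= omega_false. Qed.

(** One half is the point [10] followed by zeros, the label of [Qc 0] for [w = 0]. *)
Lemma Gamma_isomorphism : exists phi : Q [:: false] -> Gamma,
  isomorphism phi /\ forall y, sval (phi y) = Qlabel y.
Proof.
apply: (@Qlabel_isomorphism _ _ (Grey half_grey)) => //; first exact: letter_primitive.
by rewrite /Qlabel /map_ray /rlabel tail_half /fin wcat_cons constw_cons.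
Qed.

Lemma Qlabel_half_black i :
  Qlabel (vb half_grey i : Q [:: false]) = fin (nseq i false ++ [:: true]).
Proof.
rewrite /fin wcat_cat; case: i => [|i]; rewrite /Qlabel /map_ray /rlabel /= -/half_grey.
  by rewrite omega_false shift_constw wcat_cons constw_cons wcat0.
by rewrite omega_false.
Qed.

Lemma descendant_tail w (v : Qgrey w) q : w <> [::] ->
  tail (descendant (@Qchild w) v q) = q +++ tail v.
Proof.
by move=> w0; elim: q => [|b q IHq] /=; rewrite ?wcat0 // tail_child // IHq /push -wcat_cons.
Qed.

Lemma Qlabel_descendant w (v : Qgrey w) k : w <> [::] ->
  Qlabel (map_ray (descendant (@Qchild w) v) k) = Hlabel (tail v) k.
Proof.
by move=> w0; case: k => [q|q i|q i]; rewrite /Qlabel /= descendant_tail.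
Qed.

Lemma Qlabel_grey w (y : Q w) u : Qlabel y = [:: true; false] +++ u ->
  exists2 v, y = Grey v & tail v = u.
Proof.
move=> yu.
have /(rlabel_inj (x2 := Grey u)) : rlabel (map_ray (@tail w) y) = rlabel (Grey u) by [].
by case: y {yu} => // v [] <-; exists v.
Qed.

Lemma Gamma_H_hanging : exists f : H -> Gamma,
  hanging Hroot f /\ sval (f Hroot) = fin [:: true; false; true] /\
  forall k : H, sval (f k) = Hlabel (fin [:: true]) k.
Proof.
have [phi [phi_iso phiE]] := Gamma_isomorphism.
pose v : Qgrey [:: false] := Qd ord0 [::].
have tv : tail v = fin [:: true] by rewrite /= omega_false wcat0.
have lk k : sval ((phi \o map_ray (descendant (@Qchild _) v)) k) = Hlabel (fin [:: true]) k.
  by rewrite /= phiE Qlabel_descendant // tv.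
exists (phi \o map_ray (descendant (@Qchild _) v)); split; last split=> //.
  exact: hanging_isomorphism phi_iso (H_hanging_Qd _ _).
by rewrite lk /= wcat0 /fin -wcat_cat.
Qed.

Lemma Gamma_Hl_hanging : exists f : Hl -> Gamma,
  hanging Hl_root f /\ sval (f Hl_root) = fin [:: true; true].
Proof.
have [phi [phi_iso phiE]] := Gamma_isomorphism.
have [|f [fh fr]] := @Hl_hanging_Qc [:: false] ord0; first by [].
exists (phi \o f); split; first exact: hanging_isomorphism.
rewrite /= fr phiE /Qlabel /= omega_false shift_constw -wcat_cat /fin.
by rewrite (wcat_cat [:: true; true] [:: false]) constw_cons.
Qed.

Lemma Gamma_Hr_hanging : exists f : Hr -> Gamma,
  hanging Hr_root f /\ sval (f Hr_root) = act x1 (fin [:: true; false; true]).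
Proof.
have [phi [phi_iso phiE]] := Gamma_isomorphism.
have [f [fh fr]] := @Hr_hanging_Qd [:: false] ord0 [:: false].
exists (phi \o f); split; first exact: hanging_isomorphism.
have -> : fin [:: true; false; true] = Qlabel (Grey (Qd ord0 [::]) : Q [:: false]).
  by rewrite /Qlabel /= omega_false wcat0 -wcat_cat.
by rewrite act_Qlabel //= fr phiE.
Qed.

(** In the graph of one half the ray starts at a grey vertex, which is its own
    right child and therefore carries the loop that black vertices have. *)
Lemma Gamma_black_ray w (v : Qgrey w) :
  exists (r : nat -> Q w) (rho : nat -> Gamma),
    r 0 = Black v 0 /\ geodesic_ray r /\ geodesic_ray rho /\
    (forall i, sval (rho i) = fin (nseq i false ++ [:: true])) /\
    (forall s i j, edge s (r i) (r j) <-> edge s (rho i) (rho j)).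
Proof.
have [phi [phi_iso phiE]] := Gamma_isomorphism.
have half_loop : 0 < 0 \/ Qchild false half_grey = half_grey.
  by right; congr Qc; apply: val_inj; rewrite /= modn1.
exists (fun i => vb v (i + 1)), (phi \o (fun i => vb half_grey (i + 0))).
split; [by [] | split; [|split; [|split]]].
- by apply: black_ray_geodesic; left.
- exact: geodesic_ray_isomorphism phi_iso (black_ray_geodesic half_loop).
- by move=> i; rewrite /= phiE addn0 Qlabel_half_black.
move=> s i j; case: phi_iso => _ /= <-.
apply: iff_trans (black_ray_edge _ _ _ (or_introl (ltn0Sn 0))) (iff_sym _).
exact: black_ray_edge half_loop.
Qed.

(** The hypothesis on last letters says that [v] leaves the periodic sequence
    of predecessors of [omega w] at its last letter. *)
Lemma tail_gamma v w : (v <> [::] -> last false v <> last false w) ->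
  tail (Qgamma v w) = v +++ omega w.
Proof.
case: v => [|a v] lv; first by rewrite wcat0 /= shift0.
rewrite /Qgamma /tail nth_ord_pred0 shift0 -wcat_cat cats1 lastI; congr (rcons _ _ +++ _).
have {lv} : last a v <> last false w by apply: lv.
by case: (last a v) (last false w) => [] [].
Qed.

Lemma Qlabel_Qbase b n v w : 0 < n -> (v <> [::] -> last false v <> last false w) ->
  Qlabel (Qbase b n v w) = nseq n b +++ [:: ~~ b] +++ v +++ omega w.
Proof.
move=> n_gt0 lv; rewrite -(tail_gamma lv).
case: n n_gt0 => // n _.
have [a [i [yE]]] := rlabel_run (map_ray (@tail w) (Qbase b n.+1 v w)).
rewrite /Qlabel yE grey_of_map.
case: b {yE} => /=.
  by case: n => [|n] /=; case: a => //= -; case: i => // i [<-].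
by case: a => /=; [case: i | move=> [<-]].
Qed.

Theorem theorem5p1 (x : Xomega) :
  rational x -> x <> constw false -> x <> constw true ->
  (exists! t, standard_form x t) /\
  forall (b : bool) (n : nat) (v w : word), standard_form x (b, n, v, w) ->
  exists phi : Q w -> schreier x,
    isomorphism phi /\ phi (Qbase b n v w) = schreier_base x /\
    let label (y : Q w) : Xomega := sval (phi y) in
    (* (1) *)
    label (Qbase b n v w) = x /\
    (* (2) *)
    (forall (y : Q w) (u : Xomega),
       label y = [:: true; false] +++ u ->
       (forall i, u <> shift i (omega w)) ->
       exists f : H -> Q w,
         hanging Hroot f /\ f Hroot = y /\
         forall k : H, label (f k) = Hlabel u k) /\
    (exists f : H -> Gamma,
       hanging Hroot f /\ sval (f Hroot) = fin [:: true; false; true] /\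
       forall k : H, sval (f k) = Hlabel (fin [:: true]) k) /\
    (* gv, gw, gl are the vertices 10vw^omega, 10w^omega and
       10 sigma^(|w|-1)(w^omega), and t is the vertex 110w^omega; the path in
       (3) is p followed by q, where q is its part from gw to gl *)
    exists (gv gw gl : Qgrey w) (t : Q w) (p q : seq (bool * Qgrey w)),
      label (Grey gv) = [:: true; false] +++ v +++ omega w /\
      label (Grey gw) = [:: true; false] +++ omega w /\
      label (Grey gl) = [:: true; false] +++ shift (size w).-1 (omega w) /\
      label t = [:: true; true; false] +++ omega w /\
      (* (3) *)
      upward_path (@Qchild w) gv (p ++ q) gl /\
      (forall p', upward_path (@Qchild w) gv p' gl -> p' = p ++ q) /\
      unzip1 (p ++ q) = take (size (v ++ w)).-1 (v ++ w) /\
      upward_walk (@Qchild w) gv p gw /\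
      upward_walk (@Qchild w) gw q gl /\
      (* (4) *)
      (last false w = false ->
         edge (l := Q w) x1 (Grey gw) (Grey gl)) /\
      (* (5) *)
      (last false w = true ->
         edge (l := Q w) x0 t (Grey gw) /\ edge (l := Q w) x1 t (Grey gl)) /\
      (* (6) *)
      let nontrivial_loop : seq (step (Q w)) :=
        climb (@Qchild w) q ++
        (if last false w then [:: (x1, false, t); (x0, true, Grey gw)]
         else [:: (x1, false, Grey gw)]) in
      loop (G := Q w) (Grey gw) nontrivial_loop /\
      (* (7) *)
      (forall (g : Qgrey w) (y : Q w),
         List.In (Grey g : Q w) (visited nontrivial_loop) ->
         adjacent (Grey g : Q w) y ->
         ~ List.In y (visited nontrivial_loop) ->
         (exists (r : nat -> Q w) (rho : nat -> Gamma),
            r 0 = y /\ geodesic_ray r /\ geodesic_ray rho /\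
            (forall i, sval (rho i) = fin (nseq i false ++ [:: true])) /\
            (forall s i j,
               edge s (r i) (r j) <-> edge s (rho i) (rho j))) \/
         (exists f : Hl -> Q w, hanging Hl_root f /\ f Hl_root = y) \/
         (exists f : Hr -> Q w, hanging Hr_root f /\ f Hr_root = y)) /\
      (exists f : Hl -> Gamma,
         hanging Hl_root f /\ sval (f Hl_root) = fin [:: true; true]) /\
      (exists f : Hr -> Gamma,
         hanging Hr_root f /\
         sval (f Hr_root) = act x1 (fin [:: true; false; true])).

Proof.
move=> xr x_0 x_1; split.
  have [t xt] := standard_form_exists xr x_0 x_1; exists t; split=> // t'.
  exact: standard_form_unique.
move=> b n v w [n_gt0 xE w0 wP lv].
have tgv := tail_gamma lv.
have xbase : Qlabel (Qbase b n v w) = x.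
  by rewrite Qlabel_Qbase // xE.
have [phi [phi_iso phiE]] := Qlabel_isomorphism w0 wP xbase.
exists phi; split=> //; split; first by apply: sval_inj; rewrite phiE.
move=> label; have labelE y : label y = Qlabel y := phiE y.
split; first by rewrite labelE.
split.
  move=> y u; rewrite labelE => /Qlabel_grey[[j|j p] -> tu] uw.
    by case: (uw j); rewrite -tu.
  exists (map_ray (descendant (@Qchild w) (Qd j p))); split; first exact: H_hanging_Qd.
  by split=> // k; rewrite labelE Qlabel_descendant // tu.
split; first exact: Gamma_H_hanging.
exists (Qgamma v w), (Qc ord0), (Qc ord_max), (White (Qc ord0) 0), (ascent v w), (around w).
have path := ascent_around_path lv.
do 4 (split; first by rewrite labelE /Qlabel /= ?tgv ?shift0 // -wcat_cat).
split; first exact: path.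
have child_inj c c' y y' := @Qchild_inj w c c' y y' w0 wP.
split; first by move=> p' /(upward_path_unique child_inj path).
split.
  rewrite /unzip1 map_cat -!/(unzip1 _) unzip1_ascent unzip1_around size_cat.
  rewrite -[in RHS](size_pred w0) addnS /= take_cat ltnNge leq_addr /=.
  by rewrite addKn.
split; first exact: ascent_walk.
split; first exact: around_walk.
have letter0 := nth_ord_pred0 w.
split; first by move=> lw; rewrite ray_edgeE /= letter0 lw ord_pred0.
split.
  by move=> lw; rewrite !ray_edgeE /= letter0 lw ord_pred0.
rewrite /= -around_loop_climb; split.
  apply: climb_loop; [|exact: around_loop_walk|exact: around_loop_NoDup].
  by rewrite /around_loop; case: around.
split; last by split; [exact: Gamma_Hl_hanging | exact: Gamma_Hr_hanging].
move=> g y gl gy yl; have [j [->|[wj ->]|->]] := around_loop_neighbor gl gy yl.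
- by left; exact: Gamma_black_ray.
- by right; left; exact: Hl_hanging_Qc.
by right; right; exact: Hr_hanging_Qd.
Qed.
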